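(* Let $G$ be a directed graph (loops allowed) on vertex set $\{v_1,\dots,v_N\}$, and let $\beta:\mathcal C\to\mathbb R$ be the inverse of $\mu$ for the Dirichlet convolution on closed hikes, i.e. the unique function with $\mu*\beta=\beta*\mu=\delta$. Then for all $c\in\mathcal C$, $$\beta(c)=\prod_{i=1}^N\frac{\tau_i(c)!}{\tau_{i1}(c)!\times\cdots\times\tau_{iN}(c)!}.$$
   Context: Edges of $G$ are identified with formal variables $\omega_{ij}$ (edge from $v_i$ to $v_j$). A walk is a succession of contiguous edges, identified with the monomial (product) of its edges; it is a simple cycle if it is closed and crosses no vertex twice (loops $\omega_{ii}$ and backtracks $\omega_{ij}\omega_{ji}$ count as simple cycles). A closed hike is a monomial that is a product of simple cycles, the empty product $1$ included; $\mathcal C$ is the set of closed hikes. For $c,d\in\mathcal C$, $d\mid c$ means $c=dc'$ with $c'\in\mathcal C$. The Dirichlet convolution of $f,g:\mathcal C\to\mathbb R$ is $(f*g)(c)=\sum_{d\mid c}f(d)g(c/d)$, and $\delta(1)=1$, $\delta(c)=0$ for $c\neq1$. A closed hike is self-avoiding if it crosses no vertex twice (product of pairwise vertex-disjoint simple cycles); $n(c)$ is the number of connected components of the subgraph formed by the edges of $c$. $\mu(1)=1$, $\mu(c)=(-1)^{n(c)}$ if $c$ is self-avoiding, $\mu(c)=0$ otherwise. $\tau_{ij}(c)$ is the multiplicity of $\omega_{ij}$ in $c$ and $\tau_i(c)=\sum_{j=1}^N\tau_{ij}(c)$; $0!=1$. *)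

(* Defs.v *)
From mathcomp Require Import all_boot all_order all_algebra finmap.
From mathcomp Require Import all_classical reals.
From mathcomp Require Export monalg.

Set Implicit Arguments.
Unset Strict Implicit.
Unset Printing Implicit Defensive.

Import Order.TTheory GRing.Theory Num.Theory.

Local Open Scope classical_set_scope.
Local Open Scope ring_scope.

(* The edge from v_i to v_j is the pair (i, j); edges commute, so a monomial in
   the formal variables omega_ij is an element of the free commutative monoid on
   the pairs.  The digraph itself is a relation G : rel 'I_N. *)
Notation edge N := ('I_N * 'I_N)%type.
Notation monomial N := {cmonom edge N}.

Section Cycles.
Variables (N : nat) (G : rel 'I_N).
Implicit Types (w : seq (edge N)) (s : seq (seq (edge N))).

Definition walk_monomial w : monomial N := \big[mmul/mone]_(a <- w) ucm a.

(* A closed walk crosses the vertices from which its successive edges leave.  A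
   loop [:: (i, i)] and a backtrack [:: (i, j); (j, i)] with i != j qualify. *)
Definition visited w : seq 'I_N := [seq a.1 | a <- w].

Definition simple_cycle w : bool :=
  [&& w != [::], all (fun a => G a.1 a.2) w,
      cycle (fun a b : edge N => a.2 == b.1) w & uniq (visited w)].

Definition cycles_product s : monomial N :=
  \big[mmul/mone]_(w <- s) walk_monomial w.

Definition closed_hike : set (monomial N) :=
  [set m | exists2 s, all simple_cycle s & m = cycles_product s].

Definition vertex_disjoint w1 w2 : bool :=
  [disjoint visited w1 & visited w2].

Definition self_avoiding (m : monomial N) : Prop :=
  exists s, [/\ all simple_cycle s, pairwise vertex_disjoint s
              & m = cycles_product s].

End Cycles.

Section Components.
Variable N : nat.
Implicit Types m : monomial N.

Definition tau m (i j : 'I_N) : nat := m (i, j).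

Definition tau_out m (i : 'I_N) : nat := (\sum_(j < N) tau m i j)%N.

Definition linked m : rel 'I_N :=
  [rel i j | (0 < tau m i j)%N || (0 < tau m j i)%N].

Definition support_vertices m : pred 'I_N := [pred i | [exists j, linked m i j]].

Fact linked_sym m : symmetric (linked m).
Proof. by move=> i j; rewrite /linked /= orbC. Qed.

Fact linked_connect_sym m : connect_sym (linked m).
Proof. exact/sym_connect_sym/linked_sym. Qed.

Fact linked_closed m : closed (linked m) (support_vertices m).
Proof.
move=> i j ij; apply/existsP/existsP => _; [exists i | by exists j].
by rewrite linked_sym.
Qed.

Definition num_components m : nat := n_comp (linked m) (support_vertices m).

End Components.

Section Hikes.
Variables (N : nat) (G : rel 'I_N).

(* The set closed_hike G is used below as a type. *)
Local Notation C := (closed_hike G).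

Fact closed_hike_one : mone \in C.
Proof. by rewrite inE; exists [::]; rewrite // /cycles_product big_nil. Qed.

Fact closed_hike_mul (c d : C) : mmul (val c) (val d) \in C.
Proof.
have /set_mem [s sP ->] := valP c; have /set_mem [t tP ->] := valP d.
rewrite inE; exists (s ++ t); first by rewrite all_cat sP.
by rewrite /cycles_product big_cat.
Qed.

Definition hike_one : C := exist (fun m => m \in C) _ closed_hike_one.

Definition hike_mul (c d : C) : C := exist (fun m => m \in C) _ (closed_hike_mul c d).

Definition hike_divides (d c : C) : Prop := exists c', c = hike_mul d c'.

(* The quotient c / d, meaningful when d divides c (then it is unique, see
   hike_mulK); hike_one otherwise. *)
Definition hike_div (c d : C) : C := xget hike_one [set c' | c = hike_mul d c'].

End Hikes.

Section Dirichlet.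
Variables (R : realType) (N : nat) (G : rel 'I_N).
Local Notation C := (closed_hike G).
Implicit Types (f g : C -> R) (c d : C).

(* A sum over the divisors of c, which are finitely many: see
   finite_divisors. *)
Definition dirichlet_conv f g : C -> R := fun c =>
  \sum_(d \in [set d : C | hike_divides d c]) (f d * g (hike_div c d)).

Definition dirichlet_delta : C -> R := fun c => (c == hike_one G)%:R.

Definition mobius : C -> R := fun c =>
  if c == hike_one G then 1
  else if `[< self_avoiding G (val c) >] then (-1) ^+ num_components (val c)
  else 0.

(* g is a two-sided inverse of f; for f = mobius it exists and is unique, see
   dirichlet_inverse_mobius. *)
Definition dirichlet_inverse f g : Prop :=
  dirichlet_conv f g = dirichlet_delta /\ dirichlet_conv g f = dirichlet_delta.

End Dirichlet.

Arguments mobius R {N} G.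
Arguments dirichlet_delta R {N} G.

Section Facts.
Variables (N : nat) (G : rel 'I_N).
Local Notation C := (closed_hike G).
Implicit Types c d : C.

Lemma hike_mulC c d : hike_mul c d = hike_mul d c.
Proof. by apply: val_inj; rewrite /= mulmC. Qed.

Lemma hike_mul1 c : hike_mul (hike_one G) c = c.
Proof. by apply: val_inj; rewrite /= mul1m. Qed.

Lemma hike_mulI d : injective (hike_mul d).
Proof.
move=> c c' /(congr1 val) /= /eqP/cmP e; apply/val_inj/eqP/cmP => i.
by have := e i; rewrite !cmM => /addnI.
Qed.

Lemma hike_mulK d c : hike_div (hike_mul d c) d = c.
Proof. by apply: xget_unique => //= c' /hike_mulI. Qed.

Lemma finite_divisors c : finite_set [set d : C | hike_divides d c].
Proof.
pose n := mdeg (val c).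
pose h d : {ffun edge N -> 'I_n.+1} := [ffun e => inord (val d e)].
set D := [set _ | _].
have le d e : D d -> (val d e < n.+1)%N.
  move=> [c' Ec]; rewrite ltnS /n Ec /= mdegM; apply: leq_trans (leq_addr _ _).
  rewrite mdegE; case: mdomP => // ed.
  by rewrite (big_fsetD1 e) //= leq_addr.
have hI : {in D &, injective h}.
  move=> d d' /set_mem Dd /set_mem Dd' /ffunP e.
  apply/val_inj/eqP/cmP => i; have := congr1 val (e i).
  by rewrite !ffunE /= !inordK //; apply: le.
by rewrite -(eq_finite_set (inj_card_eq hI)); apply: finite_finset.
Qed.

Lemma mdeg_hike_lt c d : d != hike_one G ->
  (mdeg (val c) < mdeg (val (hike_mul d c)))%N.
Proof.
move=> d1; rewrite /= mdegM -[ltnLHS]add0n ltn_add2r lt0n mdeg_eq0.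
by apply: contra d1 => /eqP e; apply/eqP/val_inj.
Qed.

Variable R : realType.
Implicit Types f g : C -> R.

Lemma dirichlet_convC f g : dirichlet_conv f g = dirichlet_conv g f.
Proof.
apply/funext => c; rewrite /dirichlet_conv; set D := [set _ | _].
have DK d : D d -> hike_div c (hike_div c d) = d.
  by move=> [c' ->]; rewrite hike_mulK hike_mulC hike_mulK.
have DD d : D d -> D (hike_div c d).
  by move=> [c' Ec]; exists d; rewrite Ec hike_mulK hike_mulC.
have DB : set_bij D D (hike_div c).
  split=> [|d d' /set_mem Dd /set_mem Dd' e|d Dd]; first exact: DD.
    by rewrite -(DK d) // e DK.
  by exists (hike_div c d); [apply: DD | apply: DK].
rewrite [LHS](reindex_fsbig _ _ _ _ DB).
by apply: eq_fsbigr => d /set_mem Dd; rewrite DK // mulrC.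
Qed.

Lemma dirichlet_convD1 f g c : dirichlet_conv f g c = f (hike_one G) * g c +
  \sum_(d \in [set d : C | hike_divides d c] `\ hike_one G)
     f d * g (hike_div c d).
Proof.
have one_dvd : hike_divides (hike_one G) c by exists c; rewrite hike_mul1.
have c1 : hike_div c (hike_one G) = c by rewrite -{1}(hike_mul1 c) hike_mulK.
by rewrite /dirichlet_conv (fsbigD1 _ _ _ (finite_divisors c) one_dvd) c1.
Qed.

Lemma dirichlet_inverse_mobius :
  exists! b : C -> R, dirichlet_inverse (mobius R G) b.
Proof.
pose S (g : C -> R) c :=
  \sum_(d \in [set d : C | hike_divides d c] `\ hike_one G)
     mobius R G d * g (hike_div c d).
have convS g c : dirichlet_conv (mobius R G) g c = g c + S g c.
  by rewrite dirichlet_convD1 /mobius eqxx mul1r.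
have SE g g' c : (forall c', (mdeg (val c') < mdeg (val c))%N -> g c' = g' c') ->
    S g c = S g' c.
  move=> e; apply: eq_fsbigr => d /set_mem [[c' Ec] /eqP d1].
  by rewrite e // Ec hike_mulK mdeg_hike_lt.
pose B n := iter n (fun g c => dirichlet_delta R G c - S g c) (fun=> 0).
have BE n m c : (mdeg (val c) < n)%N -> (mdeg (val c) < m)%N -> B n c = B m c.
  elim: n m c => [//|n IH] [//|m] c cn cm /=; congr (_ - _); apply: SE => c' c'c.
  by apply: IH; apply: leq_trans c'c _.
pose b c := B (mdeg (val c)).+1 c.
have bP : dirichlet_conv (mobius R G) b = dirichlet_delta R G.
  apply/funext => c; rewrite convS {1}/b /= (SE b (B (mdeg (val c)))) ?subrK //.
  by move=> c' c'c; apply: BE.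
exists b; split; first by split=> //; rewrite dirichlet_convC.
move=> b' [b'P _]; apply/funext => c.
have [n] := ubnP (mdeg (val c)); elim: n c => // n IH c cn.
have := convS b c; rewrite (SE b b').
  by rewrite bP -b'P convS => /addIr.
by move=> c' c'c; apply: IH; apply: leq_trans c'c _.
Qed.

End Facts.

(* Main.v *)
(* Write [M c] for the product of multinomials.  The self-avoiding divisors of a
   closed hike c are the monomials \prod_(i in J) omega_(i, s i) with s a
   permutation supported by J that only uses edges of c, and dividing c by such
   a monomial turns [M c] into [M c] times \prod_(i in J) P_(i, s i), where
   P_ij = tau_ij(c) / tau_i(c).  Since mu is the sign of s times (-1)^|J|,
   (mu * M)(c) = M(c) det(1 - P).  For c <> 1 this determinant vanishes because
   P is a stochastic matrix on the vertices of c. *)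
Require Import Defs.
From mathcomp Require Import all_boot all_order all_algebra fingroup perm.
From mathcomp Require Import finmap.
From mathcomp Require Import all_classical reals.
From mathcomp Require Import monalg ring.

Set Implicit Arguments.
Unset Strict Implicit.
Unset Printing Implicit Defensive.

Import Order.TTheory GRing.Theory Num.Theory.

Local Open Scope ring_scope.

(** * Degrees of a monomial at a vertex, and balance *)

Section Monomials.
Variable N : nat.
Implicit Types (m : monomial N) (w : seq (edge N)) (s : seq (seq (edge N))).
Implicit Types (i j : 'I_N).

(** The edge type is finite, so taking all of it as the support turns any multiplicity function into
    a monomial. *)
Definition monomial_of (f : edge N -> nat) : monomial N :=
  [cmonom f a | a in [fset a | a : edge N]%fset]%M.

Lemma monomial_ofE f a : monomial_of f a = f a.
Proof. by rewrite /monomial_of cmE fsfunE ifT // (in_imfset _ id). Qed.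

Definition tau_in m i : nat := (\sum_(j < N) tau m j i)%N.

(** The Eulerian condition, a local test for closed hikes: see [closed_hike_balanced] and
    [balanced_closed_hike]. *)
Definition balanced m : Prop := tau_in m =1 tau_out m.

Lemma walk_monomialE w a : walk_monomial w a = count_mem a w.
Proof.
elim: w => [|b w IH]; first by rewrite /walk_monomial big_nil cm1.
by rewrite /walk_monomial big_cons cmM -/(walk_monomial w) IH ucmE.
Qed.

Lemma cycles_product_flatten s : cycles_product s = walk_monomial (flatten s).
Proof.
elim: s => [|w s IH]; rewrite /cycles_product ?big_nil ?big_cons /=.
  by rewrite /walk_monomial big_nil.
by rewrite -/(cycles_product s) IH /walk_monomial big_cat.
Qed.

Lemma tau_outM m1 m2 i :
  tau_out (mmul m1 m2) i = (tau_out m1 i + tau_out m2 i)%N.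
Proof. by rewrite /tau_out -big_split; apply: eq_bigr => j _; apply: cmM. Qed.

Lemma tau_inM m1 m2 i :
  tau_in (mmul m1 m2) i = (tau_in m1 i + tau_in m2 i)%N.
Proof. by rewrite /tau_in -big_split; apply: eq_bigr => j _; apply: cmM. Qed.

Lemma sum_pred1 (T : finType) (x : T) : (\sum_y (x == y) = 1)%N.
Proof.
by rewrite (bigD1 x) //= eqxx big1 // => y /negPf; rewrite eq_sym => ->.
Qed.

Lemma tau_out_walk w i : tau_out (walk_monomial w) i = count_mem i (visited w).
Proof.
rewrite /tau_out /tau; under eq_bigr do rewrite walk_monomialE.
elim: w => [|[a b] w IH] /=; first by rewrite big1.
rewrite big_split /= IH; congr addn; under eq_bigr do rewrite xpair_eqE.
by case: (a == i); rewrite ?sum_pred1 ?big1.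
Qed.

Lemma tau_in_walk w i :
  tau_in (walk_monomial w) i = count_mem i [seq a.2 | a <- w].
Proof.
rewrite /tau_in /tau; under eq_bigr do rewrite walk_monomialE.
elim: w => [|[a b] w IH] /=; first by rewrite big1.
rewrite big_split /= IH; congr addn; under eq_bigr do rewrite xpair_eqE andbC.
by case: (b == i); rewrite ?sum_pred1 ?big1.
Qed.

Lemma tau_le_out m i j : (tau m i j <= tau_out m i)%N.
Proof. by rewrite /tau_out (bigD1 j) //= leq_addr. Qed.

Lemma tau_le_in m i j : (tau m i j <= tau_in m j)%N.
Proof. by rewrite /tau_in (bigD1 i) //= leq_addr. Qed.

Lemma tau_out_eq0 m : (forall i, tau_out m i = 0%N) -> m = mone.
Proof.
move=> m0; apply/eqP/cmP => -[i j]; rewrite cm1; apply/eqP.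
by have := tau_le_out m i j; rewrite m0 leqn0.
Qed.

(* Defaults to i when no edge of m leaves v_i. *)
Definition some_target m i : 'I_N := odflt i [pick j | (0 < tau m i j)%N].

Lemma tau_some_target m i :
  (0 < tau_out m i)%N -> (0 < tau m i (some_target m i))%N.
Proof.
rewrite lt0n sum_nat_eq0 => /forallPn[j]; rewrite /= -lt0n => ij.
by rewrite /some_target; case: pickP => //= /(_ j); rewrite ij.
Qed.

Lemma some_target_id m i : ~~ (0 < tau_out m i)%N -> some_target m i = i.
Proof.
rewrite /some_target; case: pickP => //= j ij; rewrite -leqNgt leqn0 => /eqP i0.
by have := tau_le_out m i j; rewrite i0 leqNgt ij.
Qed.

Lemma tau_out_some_target m i : balanced m ->
  (0 < tau_out m i)%N -> (0 < tau_out m (some_target m i))%N.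
Proof.
move=> bal /tau_some_target fi; rewrite -bal.
exact: leq_trans fi (tau_le_in _ _ _).
Qed.

End Monomials.

(** * Closed hikes as balanced monomials, and the degree test for self-avoidance *)

Section Decomposition.
Variables (N : nat) (G : rel 'I_N).
Implicit Types (m : monomial N) (w : seq (edge N)) (s : seq (seq (edge N))).
Implicit Types (i j : 'I_N).

Definition edges_in m : Prop := forall i j, (0 < tau m i j)%N -> G i j.

(** Each target is the source of the next edge, so the list of targets is the list of sources
    rotated by one. *)
Lemma simple_cycle_targets w :
  simple_cycle G w -> perm_eq [seq a.2 | a <- w] (visited w).
Proof.
case: w => // a w /and4P[_ _ /= aw _].
have path_targets b p : path (fun a b : edge N => a.2 == b.1) b p ->
    [seq x.2 | x <- belast b p] = [seq x.1 | x <- p].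
  by elim: p b => //= c p IH b /andP[/eqP-> /IH ->].
have := path_targets _ _ aw; rewrite belast_rcons => /= ->.
by rewrite map_rcons perm_rcons.
Qed.

Lemma closed_hike_balanced m : closed_hike G m -> balanced m.
Proof.
case=> s sP ->; rewrite cycles_product_flatten => i.
rewrite tau_in_walk tau_out_walk; apply/seq.permP.
elim: s sP => //= w s IH /andP[wP sP].
by rewrite /visited !map_cat perm_cat ?IH ?simple_cycle_targets.
Qed.

Lemma closed_hike_edges m : closed_hike G m -> edges_in m.
Proof.
case=> s sP -> i j; rewrite cycles_product_flatten /tau walk_monomialE.
rewrite -has_count has_pred1 => /flattenP[w ws ijw].
by have /and4P[_ /allP /(_ _ ijw)] := allP sP _ ws.
Qed.

(** Balance means that a walk along edges of [m] can leave every vertex it enters. Following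
    [some_target] is thus a walk that never stops; by finiteness it falls into an orbit, which is a
    simple cycle. *)
Lemma exists_simple_cycle m : balanced m -> edges_in m -> m != mone ->
  exists2 w, simple_cycle G w & forall a, (walk_monomial w a <= m a)%N.
Proof.
move=> bal mG m1.
pose f := some_target m.
have [x x0] : exists x, (0 < tau_out m x)%N.
  apply/existsP; apply: contraR m1 => /existsPn m0; apply/eqP/tau_out_eq0 => i.
  by apply/eqP; rewrite -leqn0 leqNgt m0.
(* The iterate of rank [order f x] repeats an earlier one, of rank [k]; this common value [y]
   therefore lies on a cycle of [f]. *)
have /loopingP/(_ (fingraph.order f x)) := looping_order f x.
case/trajectP=> k kx ky; set y := iter _ f x in ky.
have y_cycle : path.cycle (frel f) (fingraph.orbit f y).
  suff yE : y = iter (fingraph.order f x - k).-1 f (f y).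
    by rewrite -fconnect_f [X in fconnect _ _ X]yE fconnect_iter.
  by rewrite -iterSr prednK ?subn_gt0 // {2}ky -iterD subnK // ltnW.
have y_out z : z \in fingraph.orbit f y -> (0 < tau_out m z)%N.
  have out_iter n u : (0 < tau_out m u)%N -> (0 < tau_out m (iter n f u))%N.
    by move=> u0; elim: n => //= n; apply: tau_out_some_target.
  by case/trajectP=> n _ ->; apply/out_iter/out_iter.
pose w := [seq (z, f z) | z <- fingraph.orbit f y].
have visw : visited w = fingraph.orbit f y by rewrite /visited -map_comp map_id.
have edge_w a : a \in w -> (0 < m a)%N.
  by case/mapP=> z /y_out/tau_some_target zf ->.
exists w.
  apply/and4P; split.
  - by rewrite -size_eq0 size_map size_orbit -lt0n fingraph.order_gt0.
  - by apply/allP => -[i j] /edge_w; apply: mG.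
  - by rewrite cycle_map; apply: sub_cycle y_cycle => i j.
  - by rewrite visw orbit_uniq.
move=> a; rewrite walk_monomialE count_uniq_mem.
  by case: (boolP (a \in w)) => // /edge_w.
by apply: (@map_uniq _ _ fst); rewrite -/(visited w) visw orbit_uniq.
Qed.

(** Induction on the degree: a simple cycle is itself balanced, so removing one leaves a balanced
    monomial of smaller degree. *)
Lemma balanced_closed_hike m : balanced m -> edges_in m -> closed_hike G m.
Proof.
have [n] := ubnP (mdeg m); elim: n m => // n IH m mn bal mG.
have [->|m1] := eqVneq m mone; first by have := closed_hike_one G; rewrite inE.
have [w wP wm] := exists_simple_cycle bal mG m1.
pose m' := monomial_of (fun a => (m a - walk_monomial w a)%N).
have mE : m = mmul (walk_monomial w) m'.
  by apply/eqP/cmP => a; rewrite cmM monomial_ofE subnKC.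
have bal_w : balanced (walk_monomial w).
  apply: closed_hike_balanced; exists [:: w]; first by rewrite /= wP.
  by rewrite cycles_product_flatten /= cats0.
have [s sP sE] : closed_hike G m'.
  apply: IH.
  - apply: leq_trans (_ : mdeg m <= n)%N => //; rewrite mE mdegM -[ltnLHS]add0n.
    rewrite ltn_add2r lt0n mdeg_eq0; apply/eqP => w1.
    case: w wP w1 {wm m' mE bal_w} => // a w _.
    move=> /(congr1 (fun m : monomial N => m a)).
    by rewrite walk_monomialE cm1 /= eqxx.
  - by move=> i; have := bal i; rewrite mE tau_inM tau_outM bal_w => /addnI.
  - move=> i j; rewrite /tau monomial_ofE => h.
    exact: mG (leq_trans h (leq_subr _ _)).
exists (w :: s); first by rewrite /= wP.
by rewrite /cycles_product big_cons -/(cycles_product s) -sE.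
Qed.

Lemma uniq_flattenE (T : eqType) (ss : seq (seq T)) :
  uniq (flatten ss) =
  all uniq ss && pairwise (fun u v : seq T => ~~ has (mem u) v) ss.
Proof.
elim: ss => //= s ss IH; rewrite cat_uniq IH.
have -> : has (mem s) (flatten ss) = has (has (mem s)) ss.
  by elim: ss {IH} => //= t ss IH; rewrite has_cat IH.
by rewrite -all_predC /=; do !bool_congr.
Qed.

(** In any decomposition into simple cycles, [tau_out m i] counts the visits to [i]. Both sides thus
    say that the concatenated vertex lists have no repetition. *)
Lemma self_avoidingP m : closed_hike G m ->
  self_avoiding G m <-> forall i, (tau_out m i <= 1)%N.
Proof.
have outE s i : tau_out (cycles_product s) i
    = count_mem i (flatten (map (@visited N) s)).
  by rewrite cycles_product_flatten tau_out_walk /visited map_flatten.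
have disjE : pairwise (fun u v : seq 'I_N => ~~ has (mem u) v)
    =1 pairwise (fun u v : seq 'I_N => [disjoint u & v]).
  by apply: eq_pairwise => u v; rewrite disjoint_sym disjoint_has.
have uniqE s : all (simple_cycle G) s ->
    uniq (flatten (map (@visited N) s)) = pairwise (@vertex_disjoint N) s.
  move=> sP; rewrite uniq_flattenE disjE pairwise_map all_map.
  suff -> : all (preim (@visited N) uniq) s by [].
  by apply: sub_all sP => w /and4P[].
move=> [s0 s0P ->]; split=> [[s [sP sd ->]] i|m1].
  by rewrite outE count_uniq_mem ?uniqE // leq_b1.
exists s0; split=> //; rewrite -uniqE //; apply/count_mem_uniq => i.
apply/eqP; rewrite eqn_leq -{1}outE; have := m1 i.
by rewrite outE -has_pred1 has_count; case: count => // -[].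
Qed.

End Decomposition.

(** * Self-avoiding hikes as permutations with a marked support *)

Section Selections.
Variables (N : nat).
Implicit Types (m : monomial N) (J : {set 'I_N}) (s : 'S_N) (i j : 'I_N).

(** The set [J] is recorded besides [s] because a fixed point of [s] carries a loop if it lies in
    [J] and no edge otherwise. *)
Definition perm_monomial J s : monomial N :=
  monomial_of (fun a => ((a.1 \in J) && (s a.1 == a.2) : nat)).

Lemma tau_perm_monomial J s i j :
  tau (perm_monomial J s) i j = (i \in J) && (s i == j).
Proof. by rewrite /tau monomial_ofE. Qed.

Lemma tau_out_perm_monomial J s i : tau_out (perm_monomial J s) i = (i \in J).
Proof.
rewrite /tau_out; under eq_bigr do rewrite tau_perm_monomial.
by case: (i \in J); rewrite ?sum_pred1 ?big1.
Qed.

Lemma balanced_perm_monomial J s : perm_on J s -> balanced (perm_monomial J s).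
Proof.
move=> Js i; rewrite tau_out_perm_monomial -(perm_closed _ (perm_onV Js)).
rewrite /tau_in (reindex_inj (@perm_inj _ s^-1%g)) /=.
under eq_bigr do rewrite tau_perm_monomial permKV andbC.
by rewrite (bigD1 i) //= eqxx big1 ?addn0 // => j /negPf ->.
Qed.

(** The out-degrees determine [J], the edges determine [s] on [J], and [s] is the identity
    elsewhere. *)
Lemma perm_monomial_inj J J' s s' : perm_on J s -> perm_on J' s' ->
  perm_monomial J s = perm_monomial J' s' -> J = J' /\ s = s'.
Proof.
move=> Js Js' e.
have eJ : J = J'.
  apply/setP => i; have := congr1 (@tau_out N ^~ i) e.
  by rewrite /= !tau_out_perm_monomial; do 2 case: (_ \in _).
split=> //; rewrite -{}eJ in Js' e *; apply/permP => i.
case: (boolP (i \in J)) => iJ; last by rewrite !(out_perm _ iJ).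
have := congr1 (fun m => tau m i (s i)) e.
by rewrite !tau_perm_monomial iJ eqxx /=; case: eqP.
Qed.

(** By balance the in-degrees are at most one too, so [some_target] is injective on the visited
    vertices. It maps them to visited vertices and fixes the others, hence is a permutation. *)
Lemma perm_monomial_of_balanced m : balanced m ->
  (forall i, (tau_out m i <= 1)%N) ->
  exists J s, perm_on J s /\ m = perm_monomial J s.
Proof.
move=> bal m1.
pose f := some_target m.
have f_edge := @tau_some_target _ m; have f_id := @some_target_id _ m.
have f_out i := @tau_out_some_target _ m i bal.
rewrite -/f in f_edge f_id f_out.
have f_inj : injective f.
  move=> i j; case: (boolP (0 < tau_out m i)%N) => [i0|i0].
    case: (boolP (0 < tau_out m j)%N) => [j0|j0 fij].
      have fi := f_edge _ i0; have fj := f_edge _ j0 => fij.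
      apply/eqP; apply: contraT => ij; have := m1 (f i); rewrite -bal /tau_in.
      rewrite (bigD1 i) //= (bigD1 j) 1?eq_sym //= addnA leqNgt.
      by rewrite (leq_trans _ (leq_addr _ _)) // (leq_add fi) // fij.
    by have := f_out _ i0; rewrite fij f_id // (negPf j0).
  case: (boolP (0 < tau_out m j)%N) => [j0|j0]; last by rewrite !f_id.
  rewrite (f_id i) // => ij; have := f_out _ j0.
  by rewrite -ij (negPf i0).
exists [set i | 0 < tau_out m i]%N, (perm f_inj); split.
  by apply/fintype.subsetP => i; rewrite !inE permE; apply: contraR => /f_id ->.
apply/eqP/cmP => -[i j]; rewrite monomial_ofE /= inE permE -/(tau m i j).
case: (posnP (tau_out m i)) => [i0|i0].
  by apply/eqP; have := tau_le_out m i j; rewrite i0 leqn0.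
have fi := f_edge _ i0; have := m1 i; rewrite /tau_out (bigD1 (f i)) //=.
case: eqVneq => [<-|fij]; first by case: (tau m i (f i)) fi => // -[].
case: (tau m i (f i)) fi => // n _; rewrite addSn ltnS leqn0 addn_eq0.
rewrite sum_nat_eq0 => /andP[_ /forallP/(_ j)].
by rewrite eq_sym fij => /eqP.
Qed.

Lemma connect_perm_monomial J s : perm_on J s ->
  connect (linked (perm_monomial J s)) =2 fconnect s.
Proof.
move=> Js i j; apply/idP/idP; move: i j; apply: connect_sub => i j.
  rewrite /linked /= !tau_perm_monomial !lt0b.
  case/orP=> /andP[_ /eqP <-]; rewrite ?fconnect1 //.
  by rewrite fconnect_sym ?fconnect1 //; apply: perm_inj.
move=> /eqP <-; case: (boolP (i \in J)) => iJ; last by rewrite (out_perm Js).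
by apply: connect1; rewrite /linked /= tau_perm_monomial iJ eqxx.
Qed.

(** Turns the orbit count in the signature of a permutation into a count of graph components,
    comparable with [num_components]. *)
Lemma card_porbits (T : finType) (t : {perm T}) : #|porbits t| = fcard t T.
Proof.
have porbitE x y : (y \in porbit t x) = fconnect t x y.
  apply/porbitP/idP => [[n ->]|/iter_findex <-].
    by rewrite permX fconnect_iter.
  by exists (findex t x y); rewrite permX.
have tC := fconnect_sym (@perm_inj _ t).
have -> : porbits t = [set porbit t x | x in froots t].
  apply/setP => A; apply/imsetP/imsetP => [[x _ ->]|[x _ ->]]; last by exists x.
  exists (froot t x); first exact: roots_root.
  by apply/esym/eqP; rewrite eq_porbit_mem porbitE connect_root.
rewrite card_in_imset => [|x y /eqP rx /eqP ry /eqP].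
  by rewrite /n_comp_mem; apply: eq_card => x; rewrite !inE andbT.
by rewrite eq_porbit_mem porbitE tC => /(fingraph.rootP tC); rewrite rx ry.
Qed.

(** The components of the monomial are the orbits of [s] inside [J]; each vertex outside [J] is
    fixed and forms one more orbit. *)
Lemma num_components_perm_monomial J s : perm_on J s ->
  (#|porbits s| = num_components (perm_monomial J s) + #|~: J|)%N.
Proof.
move=> Js; set m := perm_monomial J s.
have eqc := connect_perm_monomial Js.
rewrite card_porbits -(eq_n_comp eqc) (n_compC (support_vertices m)).
have supp : support_vertices m =i J.
  move=> i; rewrite inE; apply/existsP/idP => [[j]|iJ].
    rewrite /linked /= !tau_perm_monomial !lt0b.
    by case/orP=> /andP[] // jJ /eqP <-; rewrite perm_closed.
  by exists (s i); rewrite /linked /= tau_perm_monomial iJ eqxx.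
congr addn; rewrite /n_comp_mem; apply: eq_card => i; rewrite !inE.
have := supp i; rewrite inE => ->.
case: (boolP (i \in J)) => iJ; rewrite ?andbF ?andbT //.
(* A vertex outside [J] is connected only to itself, so it is its own root. *)
have := connect_root (linked m) i; rewrite /m eqc => /iter_findex.
set n := findex _ _ _ => ni.
apply/eqP; rewrite -{}ni; by elim: n => //= n ->; rewrite (out_perm Js).
Qed.

(** The signature of [s] has the parity of [N] plus the number of orbits; the contribution of the
    complement of [J] cancels. *)
Lemma sign_perm_monomial (R : pzRingType) J s : perm_on J s ->
  (-1) ^+ num_components (perm_monomial J s) = (-1) ^+ s * (-1) ^+ #|J| :> R.
Proof.
move=> Js; rewrite -signr_odd -(signr_odd _ #|J|) -signr_addb; congr (_ ^+ _).
rewrite /odd_perm (num_components_perm_monomial Js) -(cardsC J) !oddD.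
by do 3 case: odd.
Qed.

End Selections.

(** * Multinomials and the determinant of the transition matrix *)

Section Multinomials.
Variables (R : realType) (N : nat).
Implicit Types (m : monomial N) (J : {set 'I_N}) (s : 'S_N).

Definition multinomial m : R :=
  \prod_(i < N) (((tau_out m i)`!)%:R / (\prod_(j < N) (tau m i j)`!)%:R).

Definition transition m : 'M[R]_N :=
  \matrix_(i, j) ((tau m i j)%:R / (tau_out m i)%:R).

(* The rows of [transition m] sum to 1 on the vertices that m visits and to 0
   elsewhere; by balance the former are also the only columns in use, so that
   their indicator is a fixed vector. *)
Lemma det_transition m : balanced m ->
  \det (1%:M - transition m) = (m == mone)%:R.
Proof.
move=> bal; have [->|m1] := eqVneq m mone.
  suff -> : transition mone = 0 by rewrite subr0 det1.
  by apply/matrixP => i j; rewrite !mxE /tau cm1 mul0r.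
(* [det0P] asks for a row vector killed from the left, while the indicator is fixed as a column:
   hence the transpose. *)
rewrite -det_tr; apply/eqP/det0P.
exists (\row_i (0 < tau_out m i)%:R).
  apply: contra m1 => /eqP/rowP m0; apply/eqP/tau_out_eq0 => i.
  by have /eqP := m0 i; rewrite !mxE pnatr_eq0 eqb0 -leqNgt leqn0 => /eqP.
apply/rowP => i; rewrite linearB /= trmx1 mulmxBr mulmx1 !mxE; apply/eqP.
rewrite subr_eq0; apply/eqP.
under eq_bigr => j _.
  rewrite !mxE (_ : _ * _ = (tau m i j)%:R / (tau_out m i)%:R); last first.
    case: posnP => [j0|]; last by rewrite mul1r.
    have := tau_le_in m i j; rewrite bal j0 leqn0 => /eqP ->.
    by rewrite !mul0r.
  over.
rewrite -mulr_suml -natr_sum -/(tau_out m i).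
case: posnP => [->|i0]; first by rewrite mul0r.
by rewrite divff // pnatr_eq0 -lt0n.
Qed.

Lemma multinomialM J s m (m' := mmul (perm_monomial J s) m) :
  multinomial m = multinomial m' * \prod_(i in J) transition m' i (s i).
Proof.
rewrite [X in _ * X]big_mkcond -big_split; apply: eq_bigr => i _ /=.
have tauE j : tau m' i j = ((i \in J) && (s i == j) + tau m i j)%N.
  by rewrite -tau_perm_monomial; apply: cmM.
rewrite mxE tau_outM tau_out_perm_monomial.
under [in RHS]eq_bigr do rewrite tauE.
rewrite tauE eqxx; case: (i \in J) => /=; last by rewrite mulr1.
(* With n = [tau_out m i] and k = [tau m i (s i)], the claim at [i] reduces to n!/k! = (n+1)!/(k+1)!
   * (k+1)/(n+1). *)
rewrite !add1n (bigD1 (s i)) //= [in RHS](bigD1 (s i)) //= eqxx.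
under [in RHS]eq_bigr => j /negPf sj do rewrite eq_sym sj add0n.
rewrite add1n !factS !natrM.
have := fact_gt0 (tau m i (s i)); set a := _`!.
have : (0 < \prod_(j | j != s i) (tau m i j)`!)%N.
  by apply: prodn_gt0 => j; apply: fact_gt0.
set b := (\prod_(_ | _) _)%N; rewrite !lt0n => b0 a0.
by field; rewrite !nat1r !pnatr_eq0 a0 b0.
Qed.

(** In the Leibniz formula each factor is a sum of an identity entry and an entry of -P; [J] is the
    set of rows where the latter is chosen. The identity entries kill the term unless [s] fixes
    every vertex outside [J]. *)
Lemma det_transition_expand m : \det (1%:M - transition m) =
  \sum_(p : {set 'I_N} * 'S_N | perm_on p.1 p.2)
    (-1) ^+ p.2 * (-1) ^+ #|p.1| * \prod_(i in p.1) transition m i (p.2 i).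
Proof.
transitivity (\sum_(p : {set 'I_N} * 'S_N) (-1) ^+ p.2 *
    \prod_i (if i \in p.1 then - transition m i (p.2 i) else (i == p.2 i)%:R)).
  rewrite -(pair_bigA _ (fun J s => (-1) ^+ s *
    \prod_i (if i \in J then - transition m i (s i) else (i == s i)%:R))).
  rewrite exchange_big; apply: eq_bigr => s _ /=.
  rewrite -mulr_sumr -bigA_distr; congr (_ * _); apply: eq_bigr => i _.
  by rewrite !mxE addrC.
rewrite [RHS]big_mkcond; apply: eq_bigr => -[J s] _ /=.
case: ifPn => [Js|/subsetPn[i]].
  rewrite -mulrA; congr (_ * _).
  rewrite (bigID (mem J)) /= [X in _ * X]big1 => [|i iJ]; last first.
    by rewrite (negPf iJ) (out_perm Js iJ) eqxx.
  rewrite mulr1 -prodrN; apply: eq_bigr => i iJ.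
  by rewrite iJ.
rewrite inE => si iJ; rewrite (bigD1 i) //= (negPf iJ) eq_sym (negPf si).
by rewrite mul0r mulr0.
Qed.

End Multinomials.

(** * The convolution of the Möbius function with the multinomial *)

Section Inverse.
Variables (R : realType) (N : nat) (G : rel 'I_N).
Local Notation C := (closed_hike G).
Implicit Types c d : C.

Lemma hike_balanced c : balanced (val c).
Proof. by apply: closed_hike_balanced (set_mem (valP c)). Qed.

Lemma hike_edges c : edges_in G (val c).
Proof. by apply: closed_hike_edges (set_mem (valP c)). Qed.

(** The quotient of balanced monomials is balanced, so divisibility among closed hikes is just
    comparison of multiplicities. *)
Lemma balanced_dvd_hike c m : balanced m -> (forall a, (m a <= val c a)%N) ->
  exists d, val d = m /\ hike_divides d c.
Proof.
move=> bal mc.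
have mC : m \in C.
  apply/mem_set/balanced_closed_hike => // i j ij.
  by apply: (@hike_edges c); apply: leq_trans ij (mc _).
pose m' := monomial_of (fun a => val c a - m a)%N.
have cE : val c = mmul m m'.
  by apply/eqP/cmP => a; rewrite cmM monomial_ofE subnKC.
have m'C : m' \in C.
  apply/mem_set/balanced_closed_hike => [i|i j].
    by have := hike_balanced c i; rewrite cE tau_inM tau_outM bal => /addnI.
  rewrite /tau monomial_ofE => h; apply: (@hike_edges c).
  exact: leq_trans h (leq_subr _ _).
exists (exist (fun m => m \in C) m mC); split=> //.
by exists (exist (fun m => m \in C) m' m'C); apply: val_inj.
Qed.

Lemma mobius_perm_monomial d J s : perm_on J s -> val d = perm_monomial J s ->
  mobius R G d = (-1) ^+ s * (-1) ^+ #|J|.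
Proof.
move=> Js dE; rewrite -(sign_perm_monomial R Js) /mobius dE.
(* [mobius] treats the empty hike apart; there [J] is empty and [s] is the identity, which gives 1
   as well. *)
case: eqVneq => [d1|_].
  move: dE; rewrite d1 /= => /esym dE.
  have J0 : J = finset.set0.
    apply/setP => i; rewrite inE.
    have := tau_out_perm_monomial J s i; rewrite dE.
    rewrite /tau_out big1 => [|j _]; last exact: cm1.
    by case: (i \in J).
  have s1 : s = 1%g by apply/permP => i; rewrite (out_perm Js) ?perm1 // J0 inE.
  by rewrite (sign_perm_monomial R Js) J0 s1 odd_perm1 cards0 mulr1.
rewrite ifT //; apply/asboolP/self_avoidingP.
  by rewrite -dE; apply: set_mem (valP d).
by move=> i; rewrite tau_out_perm_monomial leq_b1.
Qed.

Lemma mobius_neq0 d : mobius R G d != 0 ->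
  exists J s, perm_on J s /\ val d = perm_monomial J s.
Proof.
move=> d0; apply: perm_monomial_of_balanced (hike_balanced d) _.
move: d0; rewrite /mobius; case: (eqVneq d (hike_one G)) => [-> _ i|_].
  by rewrite /tau_out big1 // => j _; apply: cm1.
case: asboolP => [|_]; last by rewrite eqxx.
by move/self_avoidingP => h _; apply: h; apply: set_mem (valP d).
Qed.

Lemma mobius_conv_multinomial c :
  dirichlet_conv (mobius R G) (fun d => multinomial R (val d)) c =
  multinomial R (val c) * \det (1%:M - transition R (val c)).
Proof.
(* The pairs whose monomial divides [c]; they index the divisors where [mobius] is nonzero. *)
pose A := [set p : {set 'I_N} * 'S_N |
  perm_on p.1 p.2 & [forall i in p.1, 0 < tau (val c) i (p.2 i)]%N].
have AP p : p \in A ->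
    exists d, val d = perm_monomial p.1 p.2 /\ hike_divides d c.
  rewrite inE => /andP[Js /forall_inP pos].
  apply: balanced_dvd_hike => [|[i j]]; first exact: balanced_perm_monomial.
  rewrite monomial_ofE /=; case: (boolP (i \in p.1)) => //= iJ.
  by case: eqP => // <-; apply: pos.
pose Q p : set C := fun d =>
  val d = perm_monomial p.1 p.2 /\ hike_divides d c.
(* The default value [hike_one G] is taken only outside [A]. *)
pose h p : C := xget (hike_one G) (Q p).
have hP p : p \in A ->
    val (h p) = perm_monomial p.1 p.2 /\ hike_divides (h p) c.
  by move=> /AP[d dP]; have := @xgetI _ (hike_one G) (Q p) d dP.
have hI : set_inj [set` A]%classic h.
  move=> [J s] [J' s'] /set_mem/= p /set_mem/= p' e.
  have [hp _] := hP _ p; have [hp' _] := hP _ p'.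
  move: p p'; rewrite !inE => /andP[/= Js _] /andP[/= Js' _].
  suff [-> ->] : J = J' /\ s = s' by [].
  by apply: perm_monomial_inj; rewrite // -hp e.
(* Divisors outside the image of [A] contribute nothing, since [mobius] vanishes on them. *)
rewrite /dirichlet_conv -(fsbig_widen (h @` [set` A])%classic); last 2 first.
- by move=> _ [p /= /hP[_ ?] <-].
- move=> d [/= [c' cE] dA]; apply/eqP; rewrite mulf_eq0; apply/orP; left.
  apply: contraT => /mobius_neq0[J [s [Js dE]]]; case: dA.
  have JsA : (J, s) \in A.
    rewrite inE Js /=; apply/forall_inP => i iJ.
    by rewrite cE /tau /= cmM dE -/(tau _ _ _) tau_perm_monomial iJ eqxx.
  by exists (J, s) => //; apply: val_inj; rewrite dE; apply: (hP _ JsA).1.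
rewrite fsbig_image //.
rewrite -(@bigfs _ _ _ _ (index_enum _)) ?index_enum_uniq //; last first.
  by move=> p _; rewrite mem_index_enum.
rewrite (eq_bigl (fun p => p \in A)) //.
rewrite det_transition_expand mulr_sumr [LHS]big_mkcond [RHS]big_mkcond.
apply: eq_bigr => -[J s] _; rewrite inE /=.
(* A pair of the determinant expansion outside [A] uses an edge absent from [c], so its product of
   transitions is zero. *)
case Js: (perm_on J s) => //=; case: ifPn => [pos|/forall_inPn[i iJ]].
  have JsA : (J, s) \in A by rewrite inE Js.
  have [dE [c' cE]] := hP _ JsA.
  have vcE : val c = mmul (perm_monomial J s) (val c') by rewrite cE /= dE.
  rewrite (mobius_perm_monomial Js dE) {1}cE hike_mulK.
  by rewrite (multinomialM R J s) -vcE mulrCA.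
rewrite -leqNgt leqn0 => /eqP i0.
by rewrite (bigD1 i) //= mxE i0 !mul0r !mulr0.
Qed.

Lemma multinomial_inverse_mobius :
  dirichlet_inverse (mobius R G) (fun c => multinomial R (val c)).
Proof.
suff convE : dirichlet_conv (mobius R G) (fun c => multinomial R (val c))
    = dirichlet_delta R G by split=> //; rewrite dirichlet_convC.
apply/funext => c; rewrite mobius_conv_multinomial /dirichlet_delta.
rewrite det_transition; last exact: hike_balanced.
rewrite -[mone]/(val (hike_one G)) (inj_eq val_inj).
case: eqVneq => [->|_]; last by rewrite mulr0.
rewrite mulr1 /multinomial big1 // => i _.
by rewrite /tau_out !big1 ?divr1 // => j _; rewrite /tau cm1.
Qed.

End Inverse.

Theorem theorem2 (R : realType) (N : nat) (G : rel 'I_N)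
    (beta : closed_hike G -> R)
    (beta_inv : dirichlet_inverse (mobius R G) beta)
    (c : closed_hike G) :
  beta c = \prod_(i < N)
    (((tau_out (val c) i)`!)%:R / (\prod_(j < N) (tau (val c) i j)`!)%:R).
Proof.
have [b [_ b_unique]] := dirichlet_inverse_mobius G R.
have := b_unique _ (multinomial_inverse_mobius R G).
by rewrite (b_unique _ beta_inv) => ->.
Qed.
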